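(* Let $X$ be a finite 2-complex. There is a finite, visibly irreducible complex $Y_{\max}$ and a face-essential map $f_{\max}:Y_{\max}\to X$ such that \[ \frac{\tau(Y_{\max})}{\deg(f_{\max})}\geq\frac{\tau(Y)}{\deg(f)} \] for all face-essential maps $f:Y\to X$ with $Y$ finite and visibly irreducible.
   Context: Complexes. Graphs are oriented: a graph has sets $V,E$ of vertices and edges and maps $\iota,\tau:E\to V$; morphisms preserve $\iota,\tau$. A morphism of graphs is an immersion if any two distinct edges with the same $\iota$ or with the same $\tau$ have distinct images. A cycle is a finite connected graph in which each vertex is incident to exactly two edge-ends. A 2-complex $X=(G_X,S_X,w_X)$ consists of a graph $G_X$ (the 1-skeleton), a disjoint union $S_X$ of cycles (whose components are the faces, or 2-cells) and an immersion $w_X:S_X\to G_X$ (the attaching map). A morphism $f:Y\to X$ is a pair of graph morphisms $G_Y\to G_X$, $S_Y\to S_X$ commuting with the attaching maps, such that each component $C$ of $S_Y$ maps to its image component as a covering, of degree $\deg_C(f)$; set $\deg(f)=\sum_C\deg_C(f)$. It is a branched immersion if $G_Y\to G_X$ is an immersion and no two distinct vertices, nor two distinct edges, of $S_Y$ have the same image both in $G_Y$ and in $S_X$. Visible irreducibility. The Whitehead graph of a vertex $v$ of $X$ has as vertices the edge-ends of $G_X$ at $v$ (a loop at $v$ contributes two) and as edges the elements $u\in w_X^{-1}(v)$, where $u$ joins the images of the two edge-ends of $S_X$ at $u$. A finite complex $X$ (not necessarily connected) is visibly irreducible if: (i) no component is a point; (ii) no vertex of $G_X$ has valence 1; (iii)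 no edge $e$ of $G_X$ has $\#w_X^{-1}(e)=1$; (iv) every Whitehead graph of a vertex is connected; (v) no Whitehead graph of a vertex becomes disconnected on removing one of its vertices. Face-essential maps. Let $f:Y\to X$ be a morphism of finite complexes. By Stallings folding, $G_Y\to G_X$ factors as $G_Y\to G_{\bar Y}\to G_X$, where the first map is a finite composition of folds and is $\pi_1$-surjective, and the second is an immersion. Let $S_{\bar Y}$ be the image of $S_Y$ in the fibre product $G_{\bar Y}\times_{G_X}S_X$, with attaching map the projection to $G_{\bar Y}$. The resulting complex $\bar Y$ is the folded representative of $Y$; $f$ factors as $Y\to\bar Y\to X$ with $\bar Y\to X$ a branched immersion. The map $f$ is face-essential if $S_Y\to S_{\bar Y}$ is a bijection. The total curvature of $f$ is $\tau(Y):=\tau(f):=\deg(f)+\chi(G_Y)$, where $\chi(G_Y)$ is the Euler characteristic of the 1-skeleton. *)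

(* Defs.v *)
From mathcomp Require Import all_boot all_order all_algebra.

Set Implicit Arguments.
Unset Strict Implicit.
Unset Printing Implicit Defensive.

Import Order.TTheory GRing.Theory Num.Theory.
Local Open Scope ring_scope.

(* Every complex occurring in the theorem is finite, so finiteness is built
   into the type of graphs.  Equality of graph morphisms is always taken
   pointwise. *)

Record graph := Graph {
  vert : finType;
  edge : finType;
  src : edge -> vert;
  tgt : edge -> vert
}.

Record graph_hom (G H : graph) := GraphHom {
  hv : vert G -> vert H;
  he : edge G -> edge H;
  hom_src : forall e, src (he e) = hv (src e);
  hom_tgt : forall e, tgt (he e) = hv (tgt e)
}.

(* [(e, false)] is the end of [e] at its source, [(e, true)] the end at its
   target; a loop thus has two ends at its vertex. *)
Definition edge_end (G : graph) : finType := (edge G * bool)%type.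

Definition end_vert (G : graph) (d : edge_end G) : vert G :=
  if d.2 then tgt d.1 else src d.1.

Definition end_map (G H : graph) (p : graph_hom G H) (d : edge_end G) :
  edge_end H := (he p d.1, d.2).

Definition ends_at (G : graph) (v : vert G) : {set edge_end G} :=
  [set d | end_vert d == v].

Definition valence (G : graph) (v : vert G) : nat := #|ends_at v|.

Definition adj (G : graph) : rel (vert G) :=
  fun u v => [exists e : edge G,
    ((src e == u) && (tgt e == v)) || ((src e == v) && (tgt e == u))].

Definition euler_char (G : graph) : int := #|vert G|%:Z - #|edge G|%:Z.

Definition immersion (G H : graph) (p : graph_hom G H) : Prop :=
  forall e e' : edge G,
    src e = src e' \/ tgt e = tgt e' -> he p e = he p e' -> e = e'.

(* Bijectivity on the edge-ends at each vertex.  On a nonempty connected graph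
   this already implies surjectivity onto a component of the target. *)
Definition covering (G H : graph) (p : graph_hom G H) : Prop :=
  forall v : vert G,
    {in ends_at v &, injective (end_map p)} /\
    end_map p @: ends_at v = ends_at (hv p v).

Definition surjective_hom (G H : graph) (p : graph_hom G H) : Prop :=
  (forall y, exists x, hv p x = y) /\ (forall y, exists x, he p x = y).

Definition bijective_hom (G H : graph) (p : graph_hom G H) : Prop :=
  bijective (hv p) /\ bijective (he p).

Definition is_comp (G H K : graph) (p : graph_hom G H) (q : graph_hom H K)
  (r : graph_hom G K) : Prop := hv r =1 hv q \o hv p /\ he r =1 he q \o he p.

(* A graph is a disjoint union of cycles iff all its vertices have valence 2,
   since its components are connected and valence is computed in a component.
   The faces are the components. *)
Definition union_of_cycles (S : graph) : Prop :=
  forall v : vert S, valence v = 2.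

Record complex2 := Complex2 {
  skel : graph;
  bdry : graph;
  attach : graph_hom bdry skel;
  bdry_cycles : union_of_cycles bdry;
  attach_immersion : immersion attach
}.

Record morphism (Y X : complex2) := Morphism {
  mor_skel : graph_hom (skel Y) (skel X);
  mor_bdry : graph_hom (bdry Y) (bdry X);
  mor_attach_vert : forall u,
    hv (attach X) (hv mor_bdry u) = hv mor_skel (hv (attach Y) u);
  mor_attach_edge : forall s,
    he (attach X) (he mor_bdry s) = he mor_skel (he (attach Y) s);
  mor_covering : covering mor_bdry
}.

(* The degree of the covering of the face containing [r] onto its image: the
   number of vertices of that face in the fibre over the image of [r]. *)
Definition face_degree (Y X : complex2) (f : morphism Y X)
  (r : vert (bdry Y)) : nat :=
  #|[set u | connect (@adj (bdry Y)) r u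
             & hv (mor_bdry f) u == hv (mor_bdry f) r]|.

(* [roots] contains exactly one vertex of each component of [bdry Y]. *)
Definition degree (Y X : complex2) (f : morphism Y X) : nat :=
  (\sum_(r in roots (@adj (bdry Y))) face_degree f r)%N.

Definition total_curvature (Y X : complex2) (f : morphism Y X) : int :=
  (degree f)%:Z + euler_char (skel Y).

Definition curvature_ratio (Y X : complex2) (f : morphism Y X) : rat :=
  (total_curvature f)%:~R / (degree f)%:R.

Definition branched_immersion (Y X : complex2) (f : morphism Y X) : Prop :=
  [/\ immersion (mor_skel f),
      forall u u' : vert (bdry Y),
        hv (attach Y) u = hv (attach Y) u' ->
        hv (mor_bdry f) u = hv (mor_bdry f) u' -> u = u' &
      forall s s' : edge (bdry Y),
        he (attach Y) s = he (attach Y) s' ->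
        he (mor_bdry f) s = he (mor_bdry f) s' -> s = s'].

Definition whitehead_joins (X : complex2) (u : vert (bdry X))
  (d d' : edge_end (skel X)) : bool :=
  [exists s in ends_at u, exists s' in ends_at u,
    [&& s != s', end_map (attach X) s == d & end_map (attach X) s' == d']].

(* Adjacency in the Whitehead graph of [v], whose vertex set is [ends_at v];
   the multiplicity of its edges does not affect connectedness. *)
Definition whitehead_adj (X : complex2) (v : vert (skel X)) :
  rel (edge_end (skel X)) :=
  fun d d' => [exists u, (hv (attach X) u == v) && whitehead_joins u d d'].

(* Connectedness of the subgraph of [e] induced on [A].  The empty set counts
   as connected; in [visibly_irreducible] this never matters, since there [A]
   is nonempty by conditions (i) and (ii). *)
Definition connected_on (T : finType) (A : {set T}) (e : rel T) : Prop :=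
  {in A &, forall x y, connect [rel a b | [&& a \in A, b \in A & e a b]] x y}.

Record visibly_irreducible (X : complex2) : Prop := VisiblyIrreducible {
  (* A component is a point exactly when it is a vertex without edge-ends. *)
  vi_no_point : forall v : vert (skel X), valence v <> 0%N;
  vi_no_leaf : forall v : vert (skel X), valence v <> 1%N;
  vi_no_free_face : forall e : edge (skel X),
    #|[set s | he (attach X) s == e]| <> 1%N;
  vi_whitehead_connected : forall v : vert (skel X),
    connected_on (ends_at v) (whitehead_adj v);
  vi_no_cut_vertex : forall (v : vert (skel X)) (d : edge_end (skel X)),
    d \in ends_at v -> connected_on (ends_at v :\ d) (whitehead_adj v)
}.

Definition unordered_pair_eq (T : Type) (a b x y : T) : Prop :=
  (a = x /\ b = y) \/ (a = y /\ b = x).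

(* [p] is the quotient of [G] identifying two distinct edges [e1] and [e2]
   with a common source or a common target, and hence also the other pair of
   endpoints. *)
Definition is_fold (G H : graph) (p : graph_hom G H) : Prop :=
  exists e1 e2 : edge G,
    [/\ e1 <> e2,
        src e1 = src e2 \/ tgt e1 = tgt e2,
        surjective_hom p,
        forall a b : edge G,
          he p a = he p b <-> a = b \/ unordered_pair_eq a b e1 e2 &
        forall a b : vert G,
          hv p a = hv p b <->
          [\/ a = b, unordered_pair_eq a b (src e1) (src e2)
            | unordered_pair_eq a b (tgt e1) (tgt e2)]].

Inductive fold_composition (G : graph) :
  forall H : graph, graph_hom G H -> Prop :=
| fold_nil (p : graph_hom G G) :
    hv p =1 id -> he p =1 id -> fold_composition p
| fold_step (K H : graph) (q : graph_hom G K) (r : graph_hom K H)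
    (p : graph_hom G H) :
    fold_composition q -> is_fold r -> is_comp q r p -> fold_composition p.

(* [Y --g--> Yb --h--> X] is the factorization of [f] through the folded
   representative [Yb].  As [h] is a branched immersion, [bdry Yb] embeds in
   the fibre product of [skel Yb] and [bdry X] over [skel X]; as
   [mor_bdry g] is surjective, [bdry Yb] is the image of [bdry Y] there. *)
Definition folded_representative (Y X : complex2) (f : morphism Y X)
  (Yb : complex2) (g : morphism Y Yb) (h : morphism Yb X) : Prop :=
  [/\ is_comp (mor_skel g) (mor_skel h) (mor_skel f),
      is_comp (mor_bdry g) (mor_bdry h) (mor_bdry f),
      fold_composition (mor_skel g),
      branched_immersion h &
      surjective_hom (mor_bdry g)].

(* The folded representative exists and is unique up to isomorphism, so it is
   immaterial which one is used here. *)
Definition face_essential (Y X : complex2) (f : morphism Y X) : Prop :=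
  exists (Yb : complex2) (g : morphism Y Yb) (h : morphism Yb X),
    folded_representative f g h /\ bijective_hom (mor_bdry g).

(* Main.v *)
(* A face-essential map [f : Y -> X] folds to a branched immersion [Yb -> X].
   The part of [Y] over a vertex of [Yb] is recorded by one of finitely many
   local types, two partitions of subsets of the fibre in [S_X].  The numbers
   of occurrences of the local types satisfy linear gluing equations, one for
   each edge of [X] and each partition of its boundary fibre; visible
   irreducibility is a condition on the local types that occur; and the degree
   and the Euler characteristic are linear in these numbers.  Conversely, a
   nonnegative integral solution is glued to a complex mapping to [X]; it also
   maps to the finite-sheeted cover of [G_X] given by the gluing permutations,
   and this separates the points of its boundary in each fibre, so the map is
   face-essential by the universal property of folding.  By Dickson's lemma the
   monoid of solutions is finitely generated, and by the mediant inequality the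
   ratio is maximal at a generator. *)

From Stdlib Require Import Classical.
Require Import Defs.
From mathcomp Require Import all_boot all_order all_algebra.
From mathcomp Require Import perm lra zify.

Set Implicit Arguments.
Unset Strict Implicit.
Unset Printing Implicit Defensive.

Import Order.TTheory GRing.Theory Num.Theory.
Local Open Scope ring_scope.

(** * Dickson's lemma and maximal ratios *)

(** Induction on a list of coordinates, with [M] arbitrary. For a new coordinate [t], the list [l]
    found for the other coordinates suffices for vectors whose [t]-entry is at least every [b t]
    with [b] in [l]; the remaining vectors fall into finitely many slices with constant
    [t]-entry. *)
Lemma dickson (T : finType) (M : {ffun T -> nat} -> Prop) :
  exists2 l : seq {ffun T -> nat}, {in l, forall b, M b} &
    forall m, M m -> exists2 b, b \in l & forall t, (b t <= m t)%N.
Proof.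
suff: forall (r : seq T) M, exists2 l : seq {ffun T -> nat},
    {in l, forall b, M b} &
    forall m, M m -> exists2 b, b \in l & {in r, forall t, (b t <= m t)%N}.
  move=> /(_ (enum T) M) [l lM dom]; exists l => // m /dom [b bl le].
  by exists b => // t; apply: le; rewrite mem_enum.
elim=> [|t r IHr] {}M.
  have [[m Mm]|noM] := classic (exists m, M m).
    exists [:: m] => [b|m' _]; first by rewrite inE => /eqP->.
    by exists m; rewrite ?inE.
  by exists [::] => // m Mm; case: noM; exists m.
have [l lM dom] := IHr M.
pose N := (\max_(b <- l) b t)%N.
have [l' l'M dom'] : exists2 l' : seq {ffun T -> nat}, {in l', forall b, M b} &
    forall m, M m -> (m t < N)%N ->
      exists2 b, b \in l' & {in t :: r, forall t, (b t <= m t)%N}.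
  elim: N => [|N [l1 l1M dom1]]; first by exists [::].
  have [l2 l2M dom2] := IHr (fun m => M m /\ m t = N).
  exists (l1 ++ l2) => [b|m Mm].
    by rewrite mem_cat => /orP[/l1M|/l2M []].
  rewrite ltnS leq_eqVlt => /orP[/eqP mtN|ltN].
    have [b bl le] := dom2 m (conj Mm mtN).
    exists b => [|t']; first by rewrite mem_cat bl orbT.
    rewrite inE => /orP[/eqP->|/le//].
    by have [_ ->] := l2M b bl; rewrite mtN.
  have [b bl le] := dom1 m Mm ltN.
  by exists b => //; rewrite mem_cat bl.
exists (l ++ l') => [b|m Mm]; first by rewrite mem_cat => /orP[/lM|/l'M].
have [ltN|leN] := ltnP (m t) N.
  have [b bl le] := dom' m Mm ltN.
  by exists b => //; rewrite mem_cat bl orbT.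
have [b bl le] := dom m Mm.
exists b => [|t']; first by rewrite mem_cat bl.
rewrite inE => /orP[/eqP->|/le//].
by apply: leq_trans leN; apply: leq_bigmax_seq.
Qed.

Definition weight (T : finType) (g : T -> nat) (m : {ffun T -> nat}) : nat :=
  (\sum_t m t * g t)%N.

Lemma weightB (T : finType) (g : T -> nat) (m b : {ffun T -> nat}) :
  (forall t, (b t <= m t)%N) ->
  weight g m = (weight g b + weight g [ffun t => (m t - b t)%N])%N.
Proof.
move=> le; rewrite -big_split; apply: eq_bigr => t _ /=.
by rewrite ffunE -mulnDl subnKC.
Qed.

Lemma seq_max_rat (T : eqType) (l : seq T) (F : T -> rat) :
  l != [::] -> exists2 b, b \in l & {in l, forall b', F b' <= F b}.
Proof.
elim: l => [//|a l IHl] _.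
have [->|/IHl [b bl max]] := eqVneq l [::].
  by exists a; rewrite ?inE // => b'; rewrite inE => /eqP->.
have [le|lt] := leP (F a) (F b).
  exists b => [|b']; first by rewrite inE bl orbT.
  by rewrite inE => /orP[/eqP->|/max].
exists a => [|b']; first by rewrite inE eqxx.
rewrite inE => /orP[/eqP->//|/max le]; exact: le_trans le (ltW lt).
Qed.

(* The nonnegative integral solutions form a monoid which, by Dickson's lemma,
   is generated by finitely many of them; the ratio of a sum is a mediant. *)
Lemma max_weight_ratio (T : finType) (d g h : T -> nat)
    (M : {ffun T -> nat} -> Prop) :
  M [ffun=> 0%N] ->
  (forall m b, M m -> M b -> (forall t, (b t <= m t)%N) ->
     M [ffun t => (m t - b t)%N]) ->
  (forall m, M m -> weight d m = 0%N -> m = [ffun=> 0%N]) ->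
  let ratio m := ((weight d m)%:R + (weight g m)%:R - (weight h m)%:R)
                 / (weight d m)%:R : rat in
  exists2 b, M b & forall m, M m -> (0 < weight d m)%N ->
    (0 < weight d b)%N /\ ratio m <= ratio b.
Proof.
move=> M0 MB dpos ratio.
have [l lM dom] := dickson (fun m => M m /\ (0 < weight d m)%N).
(* Without solutions of positive [d]-weight the zero vector serves, the bound being vacuous. *)
have [l0|/(seq_max_rat ratio) [b bl max]] := eqVneq l [::].
  exists [ffun=> 0%N] => // m Mm dm.
  by have [b] := dom m (conj Mm dm); rewrite l0.
have [Mb db] := lM b bl.
exists b => // m Mm dm; split => //.
rewrite /ratio ler_pdivrMr ?ltr0n //.
(* With the denominator cleared, the inequality is additive in [m] and makes sense for [d]-weight
   zero. Hence elements of [l] lying below [m] can be subtracted one after another, by induction on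
   the sum of the entries. *)
have [k] := ubnP (weight (fun=> 1%N) m).
elim: k m Mm {dm} => // k IHk m Mm lek.
have [|dm] := posnP (weight d m).
  move=> /(dpos _ Mm) ->.
  have w0 g' : weight g' [ffun=> 0%N] = 0%N :> nat.
    by apply: big1 => t _; rewrite ffunE.
  by rewrite !w0 mulr0n subr0 addr0 mulr0.
have [b' b'l le] := dom m (conj Mm dm).
have [Mb' db'] := lM b' b'l.
have := IHk _ (MB _ _ Mm Mb' le).
have w1b' : (0 < weight (fun=> 1%N) b')%N.
  rewrite lt0n; apply/negP => /eqP; rewrite /weight => /eqP.
  rewrite sum_nat_eq0 => /forallP b0.
  move: db'; rewrite /weight big1 // => t _.
  by have := b0 t; rewrite muln1 /= => /eqP->.
rewrite (weightB _ le) in lek; rewrite !(weightB _ le) !natrD.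
move=> /(_ ltac:(lia)).
have := max b' b'l; rewrite {1}/ratio ler_pdivrMr ?ltr0n //.
rewrite -/(ratio b); lra.
Qed.

(* The fibres over [k0] need not be compared, as the total size is the same. *)
Lemma perm_of_fibres (P : finType) (K : finType) (F G : P -> K) (k0 : K) :
  (forall k, k != k0 -> #|[set p | F p == k]| = #|[set p | G p == k]|) ->
  exists beta : {perm P}, forall p, G (beta p) = F p.
Proof.
move=> cardFG.
have tot (H : P -> K) : (\sum_k #|[set p | H p == k]| = #|P|)%N.
  rewrite -sum1_card (partition_big H predT) //=; apply: eq_bigr => k _.
  by rewrite -sum1_card; apply: eq_bigl => p; rewrite inE.
have {}cardFG k : #|[set p | F p == k]| = #|[set p | G p == k]|.
  have [->|] := eqVneq k k0; last exact: cardFG.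
  have := tot F; rewrite -(tot G) (bigD1 k0) // [RHS](bigD1 k0) //=.
  by rewrite (eq_bigr _ cardFG) => /addIn.
pose b p := nth p (enum [set q | G q == F p]) (index p (enum [set q | F q == F p])).
have lt p : (index p (enum [set q | F q == F p]) < size (enum [set q | G q == F p]))%N.
  by rewrite -cardE -cardFG cardE index_mem mem_enum inE.
have Gb p : G (b p) = F p.
  have: b p \in enum [set q | G q == F p] by apply: mem_nth.
  by rewrite mem_enum inE => /eqP.
have binj : injective b.
  move=> p p' bpp'; have FF : F p = F p' by rewrite -!Gb bpp'.
  move: (lt p) (lt p') (bpp'); rewrite /b FF => ltp ltp'.
  rewrite (set_nth_default p') // => /eqP; rewrite nth_uniq ?enum_uniq //.
  by move=> /eqP; apply: (index_inj p); rewrite mem_enum inE ?FF.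
by exists (perm binj) => p; rewrite permE.
Qed.

(** * Folding *)

Local Open Scope nat_scope.

Definition comp_hom (G H K : graph) (p : graph_hom G H) (q : graph_hom H K) :
  graph_hom G K.
Proof.
exists (hv q \o hv p) (he q \o he p) => e /=.
- by rewrite !hom_src.
- by rewrite !hom_tgt.
Defined.

Definition id_hom (G : graph) : graph_hom G G :=
  @GraphHom G G id id (fun=> erefl) (fun=> erefl).

Lemma hom_end (G H : graph) (p : graph_hom G H) (d : edge_end G) :
  end_vert (end_map p d) = hv p (end_vert d).
Proof. by case: d => e []; rewrite /end_vert /= ?hom_src ?hom_tgt. Qed.

(* The quotient of a graph is realized on a set of representatives. *)
Section Retract.
Variables (G : graph) (cV : vert G -> vert G) (cE : edge G -> edge G).
Hypotheses (cVK : idempotent_fun cV) (cEK : idempotent_fun cE).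
Hypothesis c_src : forall e, cV (src (cE e)) = cV (src e).
Hypothesis c_tgt : forall e, cV (tgt (cE e)) = cV (tgt e).

Definition retract_vert (v : vert G) : {v : vert G | cV v == v} :=
  exist _ (cV v) (introT eqP (cVK v)).
Definition retract_edge (e : edge G) : {e : edge G | cE e == e} :=
  exist _ (cE e) (introT eqP (cEK e)).

Definition retract : graph :=
  @Graph {v : vert G | cV v == v} {e : edge G | cE e == e}
    (fun e => retract_vert (src (val e))) (fun e => retract_vert (tgt (val e))).

Definition retract_hom : graph_hom G retract.
Proof.
by exists (retract_vert : _ -> vert retract) (retract_edge : _ -> edge retract);
  move=> e; apply: val_inj; rewrite /= ?c_src ?c_tgt.
Defined.

Lemma retract_surj : surjective_hom retract_hom.
Proof.
by split=> -[x cx]; exists x; apply: val_inj; rewrite /=; apply/eqP.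
Qed.

Lemma retract_vertE u v : hv retract_hom u = hv retract_hom v <-> cV u = cV v.
Proof. by split=> [/(congr1 val)|cuv] //; apply: val_inj. Qed.

Lemma retract_edgeE u v : he retract_hom u = he retract_hom v <-> cE u = cE v.
Proof. by split=> [/(congr1 val)|cuv] //; apply: val_inj. Qed.

Variables (H : graph) (p : graph_hom G H).
Hypotheses (pcV : forall v, hv p (cV v) = hv p v).
Hypotheses (pcE : forall e, he p (cE e) = he p e).

Definition retract_lift : graph_hom retract H.
Proof.
by exists (fun v : vert retract => hv p (val v))
       (fun e : edge retract => he p (val e));
  move=> e; rewrite /= ?hom_src ?hom_tgt pcV.
Defined.

Lemma retract_liftK : is_comp retract_hom retract_lift p.
Proof. by split=> x /=; rewrite ?pcV ?pcE. Qed.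

End Retract.

Definition collapse (T : eqType) (a b x : T) : T := if x == b then a else x.

Lemma collapseK (T : eqType) (a b : T) : idempotent_fun (collapse a b).
Proof.
by move=> x; rewrite /= /collapse; case: (eqVneq x b) => [_|/negPf->//]; case: eqP.
Qed.

Lemma collapse_eq (T : eqType) (a b x y : T) :
  collapse a b x = collapse a b y <-> x = y \/ unordered_pair_eq x y a b.
Proof.
rewrite /collapse /unordered_pair_eq.
by case: (eqVneq x b) => [->|/eqP nx]; case: (eqVneq y b) => [->|/eqP ny];
  intuition congruence.
Qed.

Lemma collapse_const (T : eqType) S (f : T -> S) a b x :
  f a = f b -> f (collapse a b x) = f x.
Proof. by rewrite /collapse; case: eqP => [->|]. Qed.

Lemma exists_fold (G : graph) (e1 e2 : edge G) :
  e1 <> e2 -> src e1 = src e2 \/ tgt e1 = tgt e2 ->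
  exists (H : graph) (q : graph_hom G H),
    [/\ is_fold q, he q e1 = he q e2, #|edge H| < #|edge G| &
    forall K (r : graph_hom G K), he r e1 = he r e2 ->
      exists r' : graph_hom H K, is_comp q r' r].
Proof.
move=> ne12 common.
pose cE := collapse e1 e2.
(* One pair of endpoints coincides already, so a single identification of vertices suffices. *)
pose cV := if src e1 == src e2 then collapse (tgt e1) (tgt e2)
           else collapse (src e1) (src e2).
have cVK : idempotent_fun cV by rewrite /cV; case: ifP => _; apply: collapseK.
have cEK : idempotent_fun cE by apply: collapseK.
have cc (T : eqType) (a b : T) : collapse a b a = collapse a b b.
  by apply/collapse_eq; right; left.
have c_src e : cV (src (cE e)) = cV (src e).
  apply: (@collapse_const _ _ (fun e => cV (src e))); rewrite /cV.
  by case: ifP => [/eqP->|].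
have c_tgt e : cV (tgt (cE e)) = cV (tgt e).
  apply: (@collapse_const _ _ (fun e => cV (tgt e))); rewrite /cV.
  by case: ifP => // /eqP nsrc; case: common => // ->.
pose q := retract_hom cVK cEK c_src c_tgt.
exists (retract cE cVK), q; split.
- exists e1, e2; split=> //.
  + exact: retract_surj.
  + by move=> a b; split=> [/retract_edgeE /collapse_eq//|];
      move=> /collapse_eq/retract_edgeE; apply.
  + move=> a b.
    have E : hv q a = hv q b <-> cV a = cV b by apply: retract_vertE.
    apply: (iff_trans E); rewrite /cV; case: ifP => [/eqP es|/eqP nsrc].
      apply: (iff_trans (collapse_eq _ _ _ _)); rewrite es.
      split=> [[->|ab]|[->|[] [-> ->]|ab]]; try by [left|right].
      - exact: Or31.
      - exact: Or33.
    apply: (iff_trans (collapse_eq _ _ _ _)).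
    have et : tgt e1 = tgt e2 by case: common.
    rewrite et; split=> [[->|ab]|[->|ab|[] [-> ->]]]; try by [left|right].
    - exact: Or31.
    - exact: Or32.
- by apply/retract_edgeE/cc.
- rewrite /= card_sig; apply: proper_card; apply/properP; split.
    exact/subsetP.
  exists e2 => //; rewrite unfold_in /= /cE /collapse eqxx; exact/eqP.
- move=> K r er.
  have pE e : he r (cE e) = he r e by apply: (@collapse_const _ _ (he r)).
  have pV v : hv r (cV v) = hv r v.
    rewrite /cV; case: ifP => _; apply: (@collapse_const _ _ (hv r)).
      by rewrite -!hom_tgt er.
    by rewrite -!hom_src er.
  by exists (retract_lift cE cVK pV); apply: retract_liftK.
Qed.

Lemma fold_composition_surj (G H : graph) (p : graph_hom G H) :
  fold_composition p -> surjective_hom p.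
Proof.
elim=> {H p} [p pV pE|K H q r p _ [qV qE] [e1 [e2 [_ _ [rV rE] _ _]]] [pV pE]].
  by split=> x; exists x.
split=> z.
  by have [y <-] := rV z; have [x <-] := qV y; exists x; rewrite pV.
by have [y <-] := rE z; have [x <-] := qE y; exists x; rewrite pE.
Qed.

(* Stallings folding; the last clause says that the folded graph maps to every
   other graph through which [p] factors by an immersion. *)
Lemma stallings_folding (G H : graph) (p : graph_hom G H) :
  exists (K : graph) (q : graph_hom G K) (r : graph_hom K H),
    [/\ fold_composition q, is_comp q r p, immersion r &
    forall L (j : graph_hom G L) (i : graph_hom L H),
      immersion i -> is_comp j i p ->
      (forall a b, hv q a = hv q b -> hv j a = hv j b) /\
      (forall a b, he q a = he q b -> he j a = he j b)].
Proof.
(* The induction is on the number of edges of an intermediate graph [K]. The universal property is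
   carried along as a map out of [K], which gives the inclusion of kernels at the end. *)
suff: forall n K (q : graph_hom G K) (r : graph_hom K H),
    #|edge K| <= n -> fold_composition q -> is_comp q r p ->
    (forall L (j : graph_hom G L) (i : graph_hom L H),
      immersion i -> is_comp j i p ->
      exists k : graph_hom K L, is_comp q k j) ->
    exists (K : graph) (q : graph_hom G K) (r : graph_hom K H),
    [/\ fold_composition q, is_comp q r p, immersion r &
    forall L (j : graph_hom G L) (i : graph_hom L H),
      immersion i -> is_comp j i p ->
      exists k : graph_hom K L, is_comp q k j].
  move=> /(_ _ G (id_hom G) p (leqnn _)) [].
  - exact: fold_nil.
  - by split.
  - by move=> L j i _ _; exists j.
  move=> K [q [r [fq pqr ir univ]]]; exists K, q, r; split=> // L j i ii pji.
  have [k [kV kE]] := univ L j i ii pji.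
  by split=> a b eab; rewrite ?kV ?kE /= eab.
elim=> [|n IHn] K q r leK fq pqr univ.
  exists K, q, r; split=> // e e'.
  by have := max_card (pred1 e); rewrite card1 => /leq_trans /(_ leK).
have [ir|/not_all_ex_not [e1 /not_all_ex_not [e2]]] := classic (immersion r).
  by exists K, q, r.
move=> ni; have [common ni2] := imply_to_and _ _ ni.
have [er ne] := imply_to_and _ _ ni2.
have [K' [c [fc ec ltK' lift]]] := exists_fold ne common.
have [r' r'E] := lift _ r er.
apply: (IHn K' (comp_hom q c) r').
- by rewrite -ltnS (leq_trans ltK').
- by apply: fold_step fq fc _; split.
- by case: pqr r'E => pV pE [rV rE]; split=> x; rewrite /= ?pV ?pE /= ?rV ?rE.
- move=> L j i ii pji; have [k [kV kE]] := univ L j i ii pji.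
  (* The images of [e1] and [e2] in [L] share an endpoint and agree in [H], so the immersion [i]
     forces them to be equal and [k] passes to the fold. *)
  have ek : he k e1 = he k e2.
    apply: ii.
      by case: common => E; [left|right]; rewrite ?hom_src ?hom_tgt E.
    have [[x1 e1E] [x2 e2E]] : (exists x, he q x = e1) /\ (exists x, he q x = e2).
      by have [_ qE] := fold_composition_surj fq; split.
    have ikr x : he i (he k (he q x)) = he r (he q x).
      have := kE x; rewrite /= => <-; case: pji pqr => _ pE [_ pE'].
      by have := pE x; rewrite pE'.
    by rewrite -e1E -e2E !ikr e1E e2E.
  have [k' [k'V k'E]] := lift _ k ek.
  by exists k'; split=> x; rewrite /= ?kV ?kE /= ?k'V ?k'E.
Qed.

(** Folding identifies no more than [j] does, so a boundary separated by [j] together with the map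
    to [bdry X] stays separated after folding. The folded representative then keeps [bdry Y] as its
    boundary. *)
Lemma face_essential_of_immersion (X Y : complex2) (f : morphism Y X)
    (L : graph) (j : graph_hom (skel Y) L) (i : graph_hom L (skel X)) :
  immersion i -> is_comp j i (mor_skel f) ->
  (forall u u', hv j (hv (attach Y) u) = hv j (hv (attach Y) u') ->
     hv (mor_bdry f) u = hv (mor_bdry f) u' -> u = u') ->
  (forall s s', he j (he (attach Y) s) = he j (he (attach Y) s') ->
     he (mor_bdry f) s = he (mor_bdry f) s' -> s = s') ->
  face_essential f.
Proof.
move=> ii fji injV injE.
have [K [q [r [fq fqr ir univ]]]] := stallings_folding (mor_skel f).
have [kerV kerE] := univ L j i ii fji; case: (fqr) => fV fE.
pose w := comp_hom (attach Y) q.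
(* Edges with a common endpoint and the same image in [K] agree in [skel X], hence in [bdry X]
   because [attach X] is an immersion; then [injE] applies. *)
have iw : immersion w.
  move=> s s' common /= es; apply: injE; first exact: kerE.
  apply: (@attach_immersion X).
    by case: common => E; [left|right]; rewrite ?hom_src ?hom_tgt E.
  rewrite !mor_attach_edge !fE /=; congr (he r _); exact: es.
pose Yb := Complex2 (@bdry_cycles Y) iw.
have cov_id : covering (id_hom (bdry Y)).
  move=> v; have E : end_map (id_hom (bdry Y)) =1 id by case.
  by split=> [a b _ _|]; rewrite ?E // (eq_imset _ E) imset_id.
exists Yb, (@Morphism Y Yb q (id_hom _) (fun=> erefl) (fun=> erefl) cov_id).
have hV u : hv (attach X) (hv (mor_bdry f) u) = hv r (hv (attach Yb) u).
  by rewrite mor_attach_vert fV.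
have hE s : he (attach X) (he (mor_bdry f) s) = he r (he (attach Yb) s).
  by rewrite mor_attach_edge fE.
exists (@Morphism Yb X r (mor_bdry f) hV hE (@mor_covering _ _ f)).
split; last by split; exists id.
split=> //=.
- split=> // [u u' /= eu eu'|s s' /= es es'].
    by apply: injV eu'; apply: kerV.
  by apply: injE es'; apply: kerE.
- by split=> x; exists x.
Qed.

(** * Local types *)

(** The partition of the fibre of [pi] over [p] into fibres of [w], carried to [C] along [phi]. It
    is stored as a relation on all of [C], whose diagonal part records the points that occur. *)
Definition push (A B C P : finType) (pi : A -> P) (w : A -> B) (phi : A -> C)
  (p : P) : {set C * C} :=
  [set (phi a.1, phi a.2) | a : A * A
     & [&& pi a.1 == p, pi a.2 == p & w a.1 == w a.2]].

Definition classes_of (C : finType) (R : {set C * C}) : {set {set C}} :=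
  [set [set c' | (c, c') \in R] | c in [set c | (c, c) \in R]].

Section Push.
Variables (A B C P : finType) (pi : A -> P) (w : A -> B) (phi : A -> C).

Lemma pushP p c c' :
  reflect (exists a a', [/\ pi a = p, pi a' = p, w a = w a', phi a = c & phi a' = c'])
          ((c, c') \in push pi w phi p).
Proof.
apply: (iffP imsetP) => [[[a a']]|[a [a' [<- pa' waa' <- <-]]]].
  rewrite inE /= => /and3P[/eqP pa /eqP pa' /eqP waa'] [-> ->].
  by exists a, a'.
by exists (a, a'); rewrite // inE /= pa' waa' !eqxx.
Qed.

Lemma push_sym p c c' :
  (c, c') \in push pi w phi p -> (c', c) \in push pi w phi p.
Proof.
by move=> /pushP[a [a' [pa pa' waa' <- <-]]]; apply/pushP; exists a', a.
Qed.

Hypothesis phi_inj : forall a a', pi a = pi a' -> phi a = phi a' -> a = a'.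

Lemma push_in a a' :
  pi a = pi a' -> ((phi a, phi a') \in push pi w phi (pi a)) = (w a == w a').
Proof.
move=> paa'; apply/pushP/eqP => [[b [b' [pb pb' wbb']]]|waa'].
  by move=> /(phi_inj pb) <- /phi_inj <- //; rewrite pb'.
by exists a, a'.
Qed.

Lemma push_trans p c c' c'' :
  (c, c') \in push pi w phi p -> (c', c'') \in push pi w phi p ->
  (c, c'') \in push pi w phi p.
Proof.
move=> /pushP[a [a' [pa pa' waa' <- <-]]] /pushP[b [b' [pb pb' wbb' eb <-]]].
have ? : b = a' by apply: phi_inj; rewrite ?pb.
by subst b; apply/pushP; exists a, b'; rewrite waa'.
Qed.

Hypothesis w_pi : forall a a', w a = w a' -> pi a = pi a'.
Hypothesis w_surj : forall b, exists a, w a = b.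

(** Since [w] refines [pi], each [b] lies over a single [p], and [phi] carries its fibre onto one
    class there; different [b] give different classes because [phi] is injective on the fibres of
    [pi]. *)
Lemma card_push : #|B| = \sum_p #|classes_of (push pi w phi p)|.
Proof.
have [s sK] := fin_all_exists w_surj.
have pis a : pi (s (w a)) = pi a by apply: w_pi.
rewrite -sum1_card (partition_big (pi \o s) predT) //=.
apply: eq_bigr => p _.
rewrite sum1dep_card.
pose cls b := [set phi a | a in [set a | w a == b]].
have clsE a p' : pi a = p' ->
    [set c' | (phi a, c') \in push pi w phi p'] = cls (w a).
  move=> <-; apply/setP => c; rewrite inE; apply/pushP/imsetP.
    move=> [b [b' [pb pb' wbb' eb <-]]]; exists b' => //; rewrite inE -wbb'.
    by rewrite (phi_inj pb eb).
  by move=> [a']; rewrite inE => /eqP wa -> ; exists a, a'; split=> //; apply: w_pi.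
rewrite -(@card_in_imset _ _ cls); last first.
  move=> b b'; rewrite !inE => /eqP pb /eqP pb' eqc.
  have : phi (s b) \in cls b by apply: imset_f; rewrite inE sK.
  rewrite eqc => /imsetP[a]; rewrite inE => /eqP wa /phi_inj ea.
  have pab : pi (s b) = pi a by rewrite -(pis a) wa pb.
  by rewrite -[b]sK (ea pab).
congr #|pred_of_set _|; apply/setP => c; apply/imsetP/imsetP.
  move=> [b]; rewrite inE => /eqP pb ->; exists (phi (s b)).
    by rewrite inE -pb push_in.
  by rewrite (clsE _ p pb) sK.
move=> [d]; rewrite inE => /pushP[a [a' [pa _ _ <- _]]] ->.
by exists (w a); rewrite ?inE ?pis ?pa // (clsE _ p pa).
Qed.

Lemma card_push_diag (Z : pred C) :
  #|[set a | Z (phi a)]| = \sum_p #|[set c | Z c & (c, c) \in push pi w phi p]|.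
Proof.
rewrite -sum1_card (partition_big pi predT) //=; apply: eq_bigr => p _.
rewrite sum1dep_card -(@card_in_imset _ _ phi); last first.
  by move=> a a'; rewrite !inE => /andP[_ /eqP pa] /andP[_ /eqP pa']; apply: phi_inj; rewrite pa.
congr #|pred_of_set _|; apply/setP => c; rewrite inE; apply/imsetP/andP.
  by move=> [a]; rewrite !inE => /andP[Za /eqP pa] ->; rewrite -pa push_in.
by move=> [Zc /pushP[a [a' [pa _ _ ea _]]]]; exists a; rewrite // !inE ea Zc pa /=.
Qed.

End Push.

Lemma connect_simulation (S T : finType) (e : rel S) (e' : rel T)
    (Sim : S -> T -> Prop) :
  (forall x x' y, Sim x y -> e x x' -> exists2 y', Sim x' y' & connect e' y y') ->
  forall x x' y, Sim x y -> connect e x x' ->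
    exists2 y', Sim x' y' & connect e' y y'.
Proof.
move=> step x x' y xy /connectP[s + ->].
elim: s x y xy => [|z s IHs] x y xy /=; first by exists y.
move=> /andP[/(step _ _ _ xy)[y1 zy1 c1] /(IHs _ _ zy1)[y2 ly2 c2]].
by exists y2 => //; apply: connect_trans c1 c2.
Qed.

(* A local type records, for the part of a complex over one vertex of its
   folded representative, which elements of the fibre of the boundary (seen
   in [bdry X]) have the same vertex, respectively the same outgoing ([false])
   or incoming ([true]) edge-end, as their image in the 1-skeleton. *)
Definition local_type (X : complex2) : finType :=
  ({set vert (bdry X) * vert (bdry X)} *
   {ffun bool -> {set edge (bdry X) * edge (bdry X)}})%type.

Section LocalType.
Variable X : complex2.
Implicit Types (t : local_type X) (d : edge_end (bdry X)).

Definition same_vert t : rel (vert (bdry X)) := fun u u' => (u, u') \in t.1.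
Definition same_end t : rel (edge_end (bdry X)) :=
  fun d d' => (d.2 == d'.2) && ((d.1, d'.1) \in t.2 d.2).

(* The Whitehead graph pulled back to the boundary, minus [Z]; ends with the
   same image in the 1-skeleton count as adjacent. *)
Definition corner_step t (Z : pred (edge_end (bdry X))) :
  rel (edge_end (bdry X)) :=
  [rel d d' | [&& same_end t d d, same_end t d' d', ~~ Z d, ~~ Z d' &
                same_end t d d' || (end_vert d == end_vert d')]].

(** After the compatibility of two partial equivalence relations with [attach X], the last three
    clauses are the local forms of the conditions on free faces, connectedness and cut vertices; the
    lower bound on valence will come from [cycle_ends]. By [good_nonempty] every piece contributes
    to the boundary, so that degree zero leaves no pieces. *)
Record good t : Prop := Good {
  good_nonempty : exists u, same_vert t u u;
  good_vert_sym : symmetric (same_vert t);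
  good_vert_trans : transitive (same_vert t);
  good_end_sym : symmetric (same_end t);
  good_end_trans : transitive (same_end t);
  good_vert_attach : forall u u', same_vert t u u' ->
    hv (attach X) u = hv (attach X) u';
  good_end_attach : forall d d', same_end t d d' ->
    he (attach X) d.1 = he (attach X) d'.1;
  good_end_vert : forall d d', same_end t d d' ->
    same_vert t (end_vert d) (end_vert d');
  good_vert_end : forall d, same_vert t (end_vert d) (end_vert d) -> same_end t d d;
  good_no_free : forall d, same_end t d d -> exists2 d', d' != d & same_end t d d';
  good_connected : forall d d', same_end t d d -> same_end t d' d' ->
    same_vert t (end_vert d) (end_vert d') -> connect (corner_step t pred0) d d';
  good_no_cut : forall d0 d d', same_end t d0 d0 ->
    same_end t d d -> same_end t d' d' ->
    same_vert t (end_vert d0) (end_vert d) ->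
    same_vert t (end_vert d0) (end_vert d') ->
    ~~ same_end t d0 d -> ~~ same_end t d0 d' ->
    connect (corner_step t (same_end t d0)) d d'
}.

Definition edges_over t (b : bool) (e : edge (skel X)) :
  {set edge (bdry X) * edge (bdry X)} :=
  [set s in t.2 b | he (attach X) s.1 == e].

Definition type_verts t := #|classes_of t.1|.
(** Only outgoing ends are counted, so that an edge is counted once, at its source. *)
Definition type_edges t := #|classes_of (t.2 false)|.
(** [roots] supplies one base vertex in each face of [X]; by [degreeE] the degree is the number of
    boundary vertices over these. *)
Definition type_degree t :=
  #|[set u | u \in roots (@adj (bdry X)) & (u, u) \in t.1]|.

End LocalType.

(** * Coverings, and the degree as a count of boundary vertices *)

Lemma covering_lift (S T : graph) (p : graph_hom S T) : covering p ->
  forall u d, end_vert d = hv p u ->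
  exists2 d', end_map p d' = d & end_vert d' = u.
Proof.
move=> cov u d du; have [_ im] := cov u.
have: d \in end_map p @: ends_at u by rewrite im inE du.
by case/imsetP => d'; rewrite inE => /eqP; exists d'.
Qed.

Lemma covering_inj (S T : graph) (p : graph_hom S T) : covering p ->
  forall d d', end_vert d = end_vert d' -> end_map p d = end_map p d' -> d = d'.
Proof.
move=> cov d d' dd'; have [inj _] := cov (end_vert d).
by apply: inj; rewrite inE ?dd'.
Qed.

Lemma adj_connect_sym (S : graph) : connect_sym (@adj S).
Proof. by apply: sym_connect_sym => u v; apply: eq_existsb => e; rewrite orbC. Qed.

(** For the two endpoints of an edge, each fibre is in bijection with the lifts of that edge in the
    component of [r], a lift being sent to its end on that side. *)
Lemma covering_fibre_connected (S T : graph) (p : graph_hom S T) (r : vert S) :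
  covering p -> forall x y, connect (@adj T) x y ->
  #|[set u | connect (@adj S) r u & hv p u == x]| =
  #|[set u | connect (@adj S) r u & hv p u == y]|.
Proof.
move=> cov.
pose N x := #|[set u | connect (@adj S) r u & hv p u == x]|.
have edge_conn (s : edge S) : connect (@adj S) r (src s) = connect (@adj S) r (tgt s).
  apply: same_connect_r; first exact: adj_connect_sym.
  apply: connect1; apply/existsP; exists s.
  by rewrite !eqxx.
have end_conn d d' : d.1 = d'.1 -> connect (@adj S) r (end_vert d) =
    connect (@adj S) r (end_vert d').
  by case: d d' => [e []] [e' []] /= ->; rewrite /end_vert /= ?edge_conn.
have Nend e b : N (end_vert (e, b)) = #|[set s | connect (@adj S) r (src s) & he p s == e]|.
  rewrite /N -[RHS](@card_in_imset _ _ (fun s => end_vert (s, b))).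
    congr #|pred_of_set _|; apply/setP => u; rewrite inE; apply/andP/imsetP.
      move=> [ru /eqP pu]; have [[s b'] [es eb] su] := covering_lift cov (esym pu).
      subst b'; exists s; last by rewrite su.
      by have := end_conn (s, b) (s, false) erefl; rewrite su ru inE es eqxx => <-.
    move=> [s]; rewrite inE => /andP[rs /eqP <-] ->.
    by rewrite (end_conn _ (s, false)) // -hom_end eqxx; split=> //; exact: rs.
  move=> s s'; rewrite !inE => /andP[_ /eqP ps] /andP[_ /eqP ps'] ess'.
  have := covering_inj cov ess'; rewrite /end_map /= ps ps'.
  by move=> /(_ erefl) [].
move=> x y /connectP[q + ->]; elim: q x => [|z q IHq] x //= /andP[xz /IHq <-].
case/existsP: xz => e /orP[]/andP[/eqP <- /eqP <-].
  exact: (etrans (Nend e false) (esym (Nend e true))).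
exact: (etrans (Nend e true) (esym (Nend e false))).
Qed.

(** The degree of a face may be computed over the base vertex of its image. The sum over faces then
    becomes a count of vertices, which splits over local types. *)
Lemma degreeE (Y X : complex2) (f : morphism Y X) :
  degree f = #|[set u | hv (mor_bdry f) u \in roots (@adj (bdry X))]|.
Proof.
have cov := @mor_covering _ _ f.
pose roots := roots (@adj (bdry Y)).
have symY := @adj_connect_sym (bdry Y); have symX := @adj_connect_sym (bdry X).
have conn u v : connect (@adj (bdry Y)) u v ->
    connect (@adj (bdry X)) (hv (mor_bdry f) u) (hv (mor_bdry f) v).
  move=> uv; have [|_ <- //] := connect_simulation
    (Sim := fun u x => hv (mor_bdry f) u = x) (e' := @adj (bdry X)) _ erefl uv.
  move=> x x' _ <- /existsP[e exx']; exists (hv (mor_bdry f) x') => //.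
  apply: connect1; apply/existsP; exists (he (mor_bdry f) e).
  by case/orP: exx' => /andP[/eqP <- /eqP <-]; rewrite hom_src hom_tgt !eqxx ?orbT.
rewrite -[RHS]sum1_card (partition_big (fingraph.root (@adj (bdry Y))) (mem roots)) /=; last first.
  by move=> u _; apply: roots_root.
apply: eq_bigr => r rr; rewrite /face_degree sum1dep_card.
rewrite (covering_fibre_connected r cov (connect_root _ (hv (mor_bdry f) r))).
apply: eq_card => u; rewrite !inE.
rewrite andbC -(root_connect symY) (eqP rr) [r == _]eq_sym; apply: andb_id2r => /eqP ru.
by have /(fingraph.rootP symX) -> : connect (@adj (bdry X)) (hv (mor_bdry f) r) (hv (mor_bdry f) u)
  by apply: conn; rewrite -(root_connect symY) ru (eqP rr).
Qed.

(** * Complexes over a set of vertices *)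

Lemma attach_ends_inj (X : complex2) (a a' : edge_end (bdry X)) :
  end_vert a = end_vert a' -> end_map (attach X) a = end_map (attach X) a' ->
  a = a'.
Proof.
case: a a' => [s b] [s' b'] su [es eb]; subst b'.
suff -> : s = s' by [].
by apply: (@attach_immersion X) es; case: b su; [right|left].
Qed.

Lemma cycle_ends (X : complex2) (u : vert (bdry X)) :
  exists s s' : edge_end (bdry X),
    [/\ end_vert s = u, end_vert s' = u, s != s' &
        end_map (attach X) s != end_map (attach X) s'].
Proof.
have /eqP/cards2P [s [s' [ss' eq_ends]]] := bdry_cycles u.
have su : end_vert s = u.
  by apply/eqP; have := set21 s s'; rewrite -eq_ends inE.
have s'u : end_vert s' = u.
  by apply/eqP; have := set22 s s'; rewrite -eq_ends inE.
exists s, s'; split=> //; apply: contra ss' => /eqP E.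
by rewrite (attach_ends_inj _ E) // su.
Qed.

Lemma whitehead_adjP (X : complex2) (v : vert (skel X)) d d' : reflect
  (exists s s', [/\ s != s', hv (attach X) (end_vert s) = v,
     end_vert s' = end_vert s, end_map (attach X) s = d &
     end_map (attach X) s' = d']) (whitehead_adj v d d').
Proof.
apply: (iffP existsP) => [[u /andP[/eqP uv]]|[s [s' [ss' sv s's sd s'd]]]].
  case/existsP => s /andP[]; rewrite inE => /eqP su /existsP[s' /andP[]].
  rewrite inE => /eqP s'u /and3P[ss' /eqP sd /eqP s'd].
  by exists s, s'; rewrite su s'u.
exists (end_vert s); rewrite sv eqxx; apply/existsP; exists s.
rewrite inE eqxx; apply/existsP; exists s'.
by rewrite inE s's ss' sd s'd !eqxx.
Qed.

(** A vertex has at least two ends, so connectedness of its Whitehead graph gives each end a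
    neighbour, and an end with a neighbour is the image of a boundary end. *)
Lemma visibly_irreducible_attach_surj (Y : complex2) :
  visibly_irreducible Y -> surjective_hom (attach Y).
Proof.
case=> noP noL _ conn _.
have lift d : exists s, end_map (attach Y) s = d.
  have : 1 < #|ends_at (end_vert d)|.
    by move: (noP (end_vert d)) (noL (end_vert d)); rewrite /valence; case: #|_| => [|[]].
  move=> /card_gt1P[x [y [xv yv xy]]].
  have [z zv zd] : exists2 z, z \in ends_at (end_vert d) & z != d.
    by have [xd|] := eqVneq x d; [exists y; rewrite // -xd eq_sym|exists x].
  have dv : d \in ends_at (end_vert d) by rewrite inE.
  have /connectP[[|z' s] /=] := conn _ d z dv zv.
    by move=> _ zd'; rewrite zd' eqxx in zd.
  by move=> /andP[/and3P[_ _ /whitehead_adjP[a [a' [_ _ _ <- _]]]] _] _; exists a.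
split=> [v|e].
  have := noP v; rewrite /valence; move/eqP; rewrite -lt0n => /card_gt0P[d].
  by rewrite inE => /eqP <-; have [s <-] := lift d; exists (end_vert s); rewrite hom_end.
by have [[s b] [<- _]] := lift (e, false); exists s.
Qed.

Section Chart.
Variables (X Y : complex2) (f : morphism Y X).
Variables (P : finType) (pi : vert (bdry Y) -> P).

Let phi := hv (mor_bdry f).
Let phiE := he (mor_bdry f).
Let phiD := end_map (mor_bdry f).
Let w := hv (attach Y).
Let wE := he (attach Y).
Let wD := end_map (attach Y).
Let piD (a : edge_end (bdry Y)) := pi (end_vert a).

(* [pi] is the composite of the attaching map with the vertex map from [Y] to
   a folded complex. *)
Record chart : Prop := Chart {
  chart_attach : forall u u', w u = w u' -> pi u = pi u';
  chart_inj : forall u u', pi u = pi u' -> phi u = phi u' -> u = u';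
  chart_surj : surjective_hom (attach Y)
}.

(** An end belongs to the value of [pi] at its own vertex, so an edge of [bdry Y] is recorded twice:
    as outgoing at its source and as incoming at its target. *)
Definition ltype (p : P) : local_type X :=
  (push pi w phi p,
   [ffun b => push (fun s => piD (s, b)) wE phiE p]).

Hypothesis Ch : chart.

Lemma chart_end_inj a a' : piD a = piD a' -> phiD a = phiD a' -> a = a'.
Proof.
move=> paa' faa'; apply: (covering_inj (@mor_covering _ _ f)) => //.
by apply: chart_inj => //; rewrite /phi -!hom_end -/phiD faa'.
Qed.

Lemma chart_edge_inj b s s' :
  piD (s, b) = piD (s', b) -> phiE s = phiE s' -> s = s'.
Proof.
move=> pss' fss'; have := chart_end_inj pss'.
by rewrite /phiD /end_map /= -/phiE fss' => /(_ erefl) [].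
Qed.

Lemma chart_edge_attach b s s' : wE s = wE s' -> piD (s, b) = piD (s', b).
Proof.
by move=> wss'; apply: chart_attach => //; rewrite /w -!hom_end /end_map /= -/wE wss'.
Qed.

Lemma same_vertP p u u' : reflect
  (exists a a', [/\ pi a = p, pi a' = p, w a = w a', phi a = u & phi a' = u'])
  (same_vert (ltype p) u u').
Proof. exact: pushP. Qed.

Lemma same_endP p d d' : reflect
  (exists a a', [/\ piD a = p, piD a' = p, wD a = wD a', phiD a = d & phiD a' = d'])
  (same_end (ltype p) d d').
Proof.
apply: (iffP andP) => [[/eqP eb]|[a [a' [pa pa' [waa' eb] <- <-]]]].
  rewrite ffunE => /pushP[s [s' [ps ps' wss' es es']]].
  exists (s, d.2), (s', d.2); split=> //.
  - by rewrite /wD /end_map /= -/wE wss'.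
  - by rewrite /phiD /end_map /= -/phiE es; case: (d).
  - by rewrite /phiD /end_map /= -/phiE es' eb; case: (d').
rewrite /= eb eqxx ffunE; split=> //; apply/pushP.
by exists a.1, a'.1; split=> //; rewrite -eb -pa; case: (a).
Qed.

Lemma same_vertE a a' : pi a = pi a' ->
  same_vert (ltype (pi a)) (phi a) (phi a') = (w a == w a').
Proof. by move=> paa'; apply: push_in paa'; apply: chart_inj. Qed.

Lemma same_endE a a' : piD a = piD a' ->
  same_end (ltype (piD a)) (phiD a) (phiD a') = (wD a == wD a').
Proof.
move=> paa'; apply/same_endP/eqP => [[c [c' [pc pc' wcc']]]|waa'].
  by move=> /(chart_end_inj pc) <- /chart_end_inj <- //; rewrite pc'.
by exists a, a'.
Qed.

Lemma end_lift x : exists a, wD a = x.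
Proof.
case: x => e b; have [_ /(_ e)[s se]] := chart_surj Ch.
by exists (s, b); rewrite /wD /end_map /= -se.
Qed.

Lemma vert_lift v : exists u, w u = v.
Proof. by have [/(_ v)] := chart_surj Ch. Qed.

Lemma chart_end_attach a a' : wD a = wD a' -> piD a = piD a'.
Proof. by move=> waa'; apply: chart_attach => //; rewrite /w -!hom_end -/wD waa'. Qed.

(** Boundary ends at vertices over [v] represent the vertices of the Whitehead graph. Moving between
    ends with the same image stands still there, and moving between the two ends at one boundary
    vertex crosses an edge. [Q] is the set of removed vertices and [Z] its pullback. *)
Lemma whitehead_transfer (v : vert (skel Y)) (Q : {set edge_end (skel Y)})
    (Z : pred (edge_end (bdry X))) u :
  w u = v ->
  (forall a, piD a = pi u -> Z (phiD a) = (wD a \in Q)) ->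
  forall a a', w (end_vert a) = v -> w (end_vert a') = v ->
  wD a \notin Q -> wD a' \notin Q ->
  connect [rel x y | [&& x \in ends_at v :\: Q, y \in ends_at v :\: Q
                       & whitehead_adj v x y]] (wD a) (wD a') =
  connect (corner_step (ltype (pi u)) Z) (phiD a) (phiD a').
Proof.
move=> uv ZQ a a' av a'v aQ a'Q.
have piv c : w (end_vert c) = v -> piD c = pi u.
  by rewrite -uv => /(chart_attach Ch).
have dom c : w (end_vert c) = v -> same_end (ltype (pi u)) (phiD c) (phiD c).
  by move=> /piv <-; rewrite same_endE.
have wend c : (wD c \in ends_at v) = (w (end_vert c) == v) by rewrite inE hom_end.
pose Sim x d := exists2 c, w (end_vert c) = v & [/\ wD c = x, phiD c = d & x \notin Q].
have Sa : Sim (wD a) (phiD a) by exists a.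
have step c c' : w (end_vert c) = v -> w (end_vert c') = v ->
    wD c \notin Q -> wD c' \notin Q -> wD c = wD c' \/ end_vert c = end_vert c' ->
    connect (corner_step (ltype (pi u)) Z) (phiD c) (phiD c').
  move=> cv c'v cQ c'Q E; apply: connect1.
  rewrite /corner_step /= !dom // !ZQ ?piv // cQ c'Q /=.
  case: E => [E|E]; first by rewrite -(piv c) // same_endE ?E ?eqxx ?piv.
  by rewrite /phiD !hom_end E eqxx orbT.
apply/idP/idP => con.
(* A Whitehead edge becomes a step to the end [s] with the same image as [c], followed by a step
   across the corner at the vertex of [s]. *)
- have [|y' [c cv [wc <- _]] con'] := connect_simulation (Sim := Sim)
    (e' := corner_step (ltype (pi u)) Z) _ Sa con.
    move=> x x' d [c cv [wc <- xQ]] /and3P[]; rewrite !in_setD => /andP[_ _].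
    move=> /andP[x'Q x'v] /whitehead_adjP[s [s' [ss' sv s's sx s'x']]].
    have s'v : w (end_vert s') = v by rewrite s's.
    exists (phiD s'); first by exists s'.
    apply: (connect_trans (step c s _ _ _ _ _)) => //; rewrite ?wc //.
    - by rewrite [wD s]sx.
    - by left; rewrite [wD s]sx.
    - apply: step => //; rewrite ?[wD s]sx ?[wD s']s'x' //.
      by right.
  by apply: connect_trans con' _; apply: step; rewrite ?wc //; left.
- have [|y' [c cv [wc pc _]] con'] := connect_simulation
    (Sim := fun d x => Sim x d)
    (e' := [rel x y | [&& x \in ends_at v :\: Q, y \in ends_at v :\: Q
                       & whitehead_adj v x y]]) _ Sa con; last first.
  have -> // : wD a' = y'.
    rewrite -wc; congr wD; apply: chart_end_inj; last by rewrite pc.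
    by rewrite !piv.
  move=> d d' x [c cv [wc <- xQ]] /and5P[_ + _ nZd'].
  move=> /same_endP[c' [_ [pc' _ _ pd' _]]].
  have c'Q : wD c' \notin Q by rewrite -ZQ // pd'.
  case/orP => [|/eqP ee].
    rewrite -(piv c) // -pd' same_endE ?pc' ?piv // => /eqP wcc'.
    exists x; last exact: connect0.
    exists c'; last by split=> //; rewrite -wcc'.
    by apply/eqP; rewrite -wend -wcc' wend cv.
  have ecc' : end_vert c = end_vert c'.
    apply: (chart_inj Ch); first by rewrite -/(piD c) -/(piD c') piv.
    by rewrite /phi -!hom_end -/phiD ee pd'.
  have c'v : w (end_vert c') = v by rewrite -ecc'.
  exists (wD c'); first by exists c'.
  have [E|ncc'] := eqVneq c c'; first by rewrite -wc E.
  apply: connect1; rewrite /= !in_setD -wc c'Q !wend cv c'v eqxx wc xQ /=.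
  by apply/whitehead_adjP; exists c, c'.
Qed.

Lemma ltype_good p : visibly_irreducible Y -> (exists u, pi u = p) -> good (ltype p).
Proof.
move=> [_ _ noF conn cut] [u0 pu0]; split.
- by exists (phi u0); rewrite -pu0 same_vertE.
- by move=> u u'; apply/idP/idP; apply: push_sym.
- by move=> u' u u''; apply: push_trans; apply: chart_inj.
- have sym d d' : same_end (ltype p) d d' -> same_end (ltype p) d' d.
    by move=> /same_endP[a [a' [pa pa' waa' pd pd']]]; apply/same_endP; exists a', a.
  by move=> d d'; apply/idP/idP; apply: sym.
- move=> d' d d'' /same_endP[a [a' [pa pa' waa' <- <-]]].
  move=> /same_endP[c [c' [pc pc' wcc' /chart_end_inj ec <-]]].
  by apply/same_endP; exists a, c'; rewrite waa' -wcc' ec ?pc.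
- move=> u u' /same_vertP[a [a' [_ _ waa' <- <-]]].
  by rewrite !(mor_attach_vert f) -/w waa'.
- move=> d d' /same_endP[a [a' [_ _ [waa' _] <- <-]]].
  by rewrite !(mor_attach_edge f) waa'.
- move=> d d' /same_endP[a [a' [pa pa' waa' <- <-]]].
  rewrite /phiD !hom_end -pa same_vertE -/(piD a) -?/(piD a') ?pa ?pa' //.
  by rewrite /w -!hom_end -/wD waa'.
- move=> d /same_vertP[u [_ [pu _ _ ud _]]].
  have [a <- au] := covering_lift (@mor_covering _ _ f) (esym ud).
  by rewrite -pu -au same_endE.
- move=> d /same_endP[a [_ [pa _ _ <- _]]].
  have [s' s'a ws'] : exists2 s', s' != a.1 & wE s' = wE a.1.
    have := noF (wE a.1); set Fe := [set s | _] => nF.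
    have : 0 < #|Fe :\ a.1|.
      by move: nF; rewrite (cardsD1 a.1 Fe) inE eqxx; case: #|_|.
    by case/card_gt0P => s'; rewrite !inE => /andP[? /eqP]; exists s'.
  have wa : wD a = wD (s', a.2) by rewrite /wD /end_map /= -/wE ws'.
  have ps' : piD a = piD (s', a.2) by apply: chart_end_attach.
  exists (phiD (s', a.2)); last by rewrite -pa same_endE ?wa.
  apply: contra s'a => /eqP E; apply/eqP.
  by rewrite -(chart_end_inj (esym ps') E).
- move=> d d' /same_endP[a [_ [pa _ _ <- _]]] /same_endP[a' [_ [pa' _ _ <- _]]].
  rewrite /phiD !hom_end -pa same_vertE; last by rewrite -!/(piD _) pa pa'.
  move=> /eqP waa'.
  rewrite -(@whitehead_transfer _ set0 _ (end_vert a) erefl) ?inE //.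
  + rewrite setD0; apply: conn; rewrite inE hom_end ?eqxx //.
    by rewrite -/w waa'.
  + by move=> c _; rewrite in_set0.
- move=> d0 d d' /same_endP[a0 [_ [pa0 _ _ <- _]]].
  move=> /same_endP[a [_ [pa _ _ <- _]]] /same_endP[a' [_ [pa' _ _ <- _]]].
  rewrite -pa0 !same_endE ?pa ?pa' //.
  rewrite /phiD !hom_end !same_vertE; try by rewrite -!/(piD _) pa0 ?pa ?pa'.
  move=> /eqP wa /eqP wa' na na'.
  (* Among the ends over [p], those in the class of [d0] are exactly the ones mapping to the removed
     Whitehead vertex [wD a0]. *)
  rewrite -(@whitehead_transfer (w (end_vert a0)) [set wD a0] _ (end_vert a0) erefl) ?in_set1 //.
  + apply: cut; rewrite !inE ?(eq_sym _ (wD a0)) ?na ?na' ?hom_end ?eqxx //.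
      by rewrite -/w wa eqxx.
    by rewrite -/w wa' eqxx.
  + by move=> c pc; rewrite inE -/phiD same_endE // eq_sym.
  + by rewrite eq_sym.
  + by rewrite eq_sym.
Qed.

Lemma chart_visibly_irreducible :
  (forall p, (exists u, pi u = p) -> good (ltype p)) -> visibly_irreducible Y.
Proof.
move=> gd; have {}gd u : good (ltype (pi u)) by apply: gd; exists u.
(* The attaching map is an immersion, so the two ends at a boundary vertex have distinct images;
   this bounds the valence below by 2. *)
have ends (v : vert (skel Y)) : exists x y, [/\ x \in ends_at v, y \in ends_at v & x != y].
  have [u uv] := vert_lift v; have [s [s' [su s'u _ ws]]] := cycle_ends u.
  by exists (wD s), (wD s'); split=> //; rewrite inE hom_end ?su ?s'u -/w uv.
have val (v : vert (skel Y)) : 1 < valence v.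
  by apply/card_gt1P; have [x [y [xv yv xy]]] := ends v; exists x, y.
split=> [v v0|v v1|e|v x y|v z zv x y].
- by have := val v; rewrite v0.
- by have := val v; rewrite v1.
- have [_ /(_ e)[s se]] := chart_surj Ch.
  have ds : same_end (ltype (piD (s, false))) (phiD (s, false)) (phiD (s, false)).
    by rewrite same_endE.
  have [d' d's] := good_no_free (gd (end_vert (s, false))) ds.
  move=> /same_endP[a [a' [pa pa' waa' /chart_end_inj E pd']]].
  move=> /eqP/cards1P[s0 E0].
  have ea : a = (s, false) by apply: E; rewrite pa.
  have : s \in [set s0] by rewrite -E0 inE se.
  have : a'.1 \in [set s0].
    by rewrite -E0 inE; case: waa' => + _; rewrite ea /= => <-; rewrite se.
  rewrite !inE => /eqP es' /eqP es; case/negP: d's; rewrite -pd' -ea.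
  by case: waa' => _ eb; apply/eqP; congr phiD; case: (a) (a') ea eb es' es => ? ? [? ?] [-> ->] /= <- -> ->.
- rewrite !inE => /eqP xv /eqP yv.
  have [a ax] := end_lift x; have [a' ay] := end_lift y; subst x y.
  rewrite !hom_end in xv yv.
  rewrite -[ends_at v]setD0.
  rewrite (@whitehead_transfer v set0 pred0 (end_vert a)) ?inE //; last first.
    by move=> c _; rewrite in_set0.
  have paa' : piD a = piD a' by apply: (chart_attach Ch); rewrite /w xv yv.
  apply: good_connected.
  + exact: gd.
  + by rewrite same_endE.
  + by rewrite -/(piD a) paa' same_endE.
  + by rewrite /phiD !hom_end same_vertE // /w xv yv.
- move: zv; rewrite !inE => /eqP zv /andP[xz /eqP xv] /andP[yz /eqP yv].
  have [a0 az] := end_lift z.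
  have [a ax] := end_lift x; have [a' ay] := end_lift y; subst x y z.
  rewrite !hom_end in xv yv zv.
  have pa : piD a0 = piD a by apply: (chart_attach Ch); rewrite /w xv zv.
  have pa' : piD a0 = piD a' by apply: (chart_attach Ch); rewrite /w yv zv.
  rewrite (@whitehead_transfer v [set wD a0] (same_end (ltype (piD a0)) (phiD a0)) (end_vert a0)) ?inE //; last first.
    by move=> c pc; rewrite inE same_endE // eq_sym.
  apply: good_no_cut.
  + exact: gd.
  + by rewrite same_endE.
  + by rewrite -/(piD a0) pa same_endE.
  + by rewrite -/(piD a0) pa' same_endE.
  + by rewrite /phiD !hom_end same_vertE // /w zv xv.
  + by rewrite /phiD !hom_end same_vertE // /w zv yv.
  + by rewrite same_endE // eq_sym.
  + by rewrite same_endE // eq_sym.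
Qed.

Lemma chart_card_vert : #|vert (skel Y)| = \sum_p type_verts (ltype p).
Proof.
apply: card_push; [exact: chart_inj|exact: chart_attach|exact: vert_lift].
Qed.

Lemma chart_card_edge : #|edge (skel Y)| = \sum_p type_edges (ltype p).
Proof.
rewrite /type_edges; under eq_bigr => p _ do rewrite ffunE.
apply: card_push.
- exact: chart_edge_inj.
- exact: chart_edge_attach.
- by have [_] := chart_surj Ch.
Qed.

Lemma chart_degree : degree f = \sum_p type_degree (ltype p).
Proof. by rewrite degreeE; apply: (card_push_diag _ (chart_inj Ch) (mem (roots _))). Qed.

End Chart.

(** * Gluing local types *)

(** [m] counts the pieces of each local type. The equations ask that as many pieces show the pattern
    [R] on their outgoing ends over [e] as on their incoming ones; the empty pattern marks pieces
    with nothing to glue along [e]. *)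
Record feasible (X : complex2) (m : {ffun local_type X -> nat}) : Prop :=
  Feasible {
    feasible_good : forall t, 0 < m t -> good t;
    feasible_glue : forall e R, R != set0 ->
      weight (fun t => edges_over t false e == R : nat) m =
      weight (fun t => edges_over t true e == R : nat) m
  }.

Lemma weight_count (P T : finType) (t : P -> T) (g : T -> nat) :
  weight g [ffun x => #|[set p | t p == x]|] = \sum_p g (t p).
Proof.
rewrite (partition_big t predT) //=; apply: eq_bigr => x _.
rewrite ffunE -sum1dep_card big_distrl /=.
by apply: eq_bigr => p /eqP ->; rewrite mul1n.
Qed.

Lemma weight_tagged (T : finType) (m : {ffun T -> nat}) (g : T -> nat) :
  \sum_(p : {t : T & 'I_(m t)}) g (tag p) = weight g m.
Proof.
rewrite /weight -(@sig_big_dep _ _ _ _ (fun t => 'I_(m t)) predT (fun=> predT) (fun t _ => g t)).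
by apply: eq_bigr => t _; rewrite sum_nat_const card_ord.
Qed.

Lemma card_set_sum (P : finType) (Z : pred P) : #|[set p | Z p]| = \sum_p (Z p : nat).
Proof. by rewrite -sum1dep_card big_mkcond. Qed.

(** [m] counts the vertices of the folded representative by local type. An edge [eps] of it shows
    the same pattern [Re eps] at both ends and, by the immersion to [skel X], is determined by its
    image and either endpoint. So both sides of a gluing equation count the edges over [e] with
    pattern [R]. *)
Lemma feasible_of_essential (X Y : complex2) (f : morphism Y X) :
  visibly_irreducible Y -> face_essential f ->
  exists m : {ffun local_type X -> nat},
    [/\ feasible m, degree f = weight (@type_degree X) m,
        #|vert (skel Y)| = weight (@type_verts X) m &
        #|edge (skel Y)| = weight (@type_edges X) m].
Proof.
move=> viY [Yb [g [h [[[fgV fgE] [fbV fbE] fold [imm brV _] _] [bijV _]]]]].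
pose pi u := hv (mor_skel g) (hv (attach Y) u).
have ch : chart f pi.
  split.
  - by move=> u u'; rewrite /pi => ->.
  - move=> u u' puu' fuu'; apply: (bij_inj bijV); apply: brV.
      by rewrite !mor_attach_vert.
    by move: fuu'; rewrite !fbV.
  - exact: visibly_irreducible_attach_surj.
pose lt := ltype f pi.
exists [ffun t => #|[set p | lt p == t]|].
rewrite !weight_count; split; [split|exact: chart_degree|exact: chart_card_vert|exact: chart_card_edge].
  move=> t; rewrite ffunE => /card_gt0P[p]; rewrite inE => /eqP <-.
  apply: ltype_good => //.
  have [/(_ p)[v vp] _] := fold_composition_surj fold.
  by have [u uv] := vert_lift ch v; exists u; rewrite /pi uv.
move=> e R nR.
pose Re := push (fun s => he (mor_skel g) (he (attach Y) s)) (he (attach Y)) (he (mor_bdry f)).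
have over s : he (attach X) (he (mor_bdry f) s) =
    he (mor_skel h) (he (mor_skel g) (he (attach Y) s)).
  by rewrite (mor_attach_edge f) fgE.
have piE s b : pi (end_vert (s, b)) =
    end_vert (he (mor_skel g) (he (attach Y) s), b).
  by rewrite /pi -!hom_end.
have same eps eps' b : he (mor_skel h) eps = he (mor_skel h) eps' ->
    end_vert (eps, b) = end_vert (eps', b) -> eps = eps'.
  by move=> E; case: b => Ev; apply: imm E; [right|left].
have ReE eps b : edges_over (lt (end_vert (eps, b))) b (he (mor_skel h) eps) = Re eps.
  apply/setP => -[s s']; rewrite inE ffunE /=; apply/andP/idP.
    move=> [/pushP[a [a' [pa pa' waa' <- <-]]] /eqP]; rewrite over => ea.
    have {}ea : he (mor_skel g) (he (attach Y) a) = eps.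
      by apply: (same _ _ b) => //; rewrite -pa piE.
    by apply/pushP; exists a, a'; rewrite -waa'.
  move=> /pushP[a [a' [pa pa' waa' <- <-]]]; split; last by rewrite over pa.
  by apply/pushP; exists a, a'; rewrite !piE pa pa'.
have count b : \sum_p (edges_over (lt p) b e == R : nat) =
    #|[set eps | (he (mor_skel h) eps == e) && (Re eps == R)]|.
  rewrite -card_set_sum -[RHS](@card_in_imset _ _ (fun eps => end_vert (eps, b))).
    congr #|pred_of_set _|; apply/setP => p; rewrite inE; apply/eqP/imsetP.
      (* As [R] is nonempty, some boundary edge over [e] has its [b]-end over [p]; its image in [Yb]
         is the required edge. *)
      move=> Rp; move: (nR); rewrite -Rp => /set0Pn[[s s']].
      rewrite !inE ffunE => /andP[/pushP[a [a' [pa _ _ ea _]]] /= /eqP eX].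
      exists (he (mor_skel g) (he (attach Y) a)); last by rewrite -piE.
      by rewrite inE -(ReE _ b) -over ea eX -piE pa Rp !eqxx.
    by move=> [eps]; rewrite inE => /andP[/eqP <- /eqP <-] ->; rewrite ReE.
  move=> eps eps'; rewrite !inE => /andP[/eqP E _] /andP[/eqP E' _].
  by apply: same; rewrite E.
by rewrite !weight_count !count.
Qed.

Lemma degree_gt0 (X Y : complex2) (f : morphism Y X) (u : vert (bdry Y)) :
  0 < degree f.
Proof.
have rr := roots_root (@adj_connect_sym (bdry Y)) u.
rewrite /degree (bigD1 (fingraph.root (@adj (bdry Y)) u)) //= ltn_addr //.
apply/card_gt0P; exists (fingraph.root (@adj (bdry Y)) u).
by rewrite inE connect0 eqxx.
Qed.

Section Canon.
Variables (T : finType) (r : rel T).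
Hypotheses (r_refl : reflexive r) (r_sym : symmetric r) (r_trans : transitive r).

(** The [pick] depends only on the class of [x]; its default is never taken, [r] being reflexive. *)
Definition canon (x : T) : T := odflt x [pick y | r x y].

Lemma canon_rel x : r x (canon x).
Proof. by rewrite /canon; case: pickP => [y //|/(_ x)]; rewrite r_refl. Qed.

Lemma canon_eq x y : canon x = canon y <-> r x y.
Proof.
split=> [E|rxy].
  by apply: (r_trans (canon_rel x)); rewrite E r_sym canon_rel.
have E : r x =1 r y by apply: left_trans => //.
rewrite /canon (eq_pick E); case: pickP => [//|/(_ y)]; rewrite r_refl //.
Qed.

Lemma canonK : idempotent_fun canon.
Proof. by move=> x; apply/canon_eq; rewrite r_sym canon_rel. Qed.

End Canon.

(** * The complex glued from a family of local types *)

Section Model.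
Variables (X : complex2) (P : finType) (t : P -> local_type X).
Variable beta : edge (skel X) -> {perm P}.
Hypothesis t_good : forall p, good (t p).
Hypothesis t_glue : forall e p,
  edges_over (t (beta e p)) true e = edges_over (t p) false e.

Lemma model_glue p s s' :
  same_end (t (beta (he (attach X) s) p)) (s, true) (s', true) =
  same_end (t p) (s, false) (s', false).
Proof.
have := congr1 (fun A : {set _} => (s, s') \in A) (t_glue (he (attach X) s) p).
by rewrite /same_end !inE /= !eqxx !andbT.
Qed.

Definition model_vert := {x : P * vert (bdry X) | same_vert (t x.1) x.2 x.2}.
(** An edge is stored with the piece [p] of its source; its target lies in the piece [beta e p],
    where [e] is its image in [skel X]. *)
Definition model_edge :=
  {x : P * edge (bdry X) | same_end (t x.1) (x.2, false) (x.2, false)}.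

Fact model_src_subproof (x : model_edge) :
  same_vert (t (val x).1) (src (val x).2) (src (val x).2).
Proof. have H := valP x; exact: (good_end_vert (t_good _) H). Qed.

Fact model_tgt_subproof (x : model_edge) :
  same_vert (t (beta (he (attach X) (val x).2) (val x).1))
    (tgt (val x).2) (tgt (val x).2).
Proof.
have := valP x; rewrite -model_glue => H; exact: (good_end_vert (t_good _) H).
Qed.

Definition model_bdry : graph :=
  @Graph model_vert model_edge
    (fun x => exist _ ((val x).1, src (val x).2) (model_src_subproof x))
    (fun x => exist _ (beta (he (attach X) (val x).2) (val x).1, tgt (val x).2)
                (model_tgt_subproof x)).

Definition model_phi : graph_hom model_bdry (bdry X) :=
  @GraphHom model_bdry (bdry X) (fun x => (val x).2) (fun x => (val x).2)
    (fun=> erefl) (fun=> erefl).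

(** At a vertex in the piece [p], an outgoing end lifts to an edge stored at [p], and an incoming
    end over [e] to an edge stored at the preimage of [p] under [beta e]. The lifts exist by
    [good_vert_end] and are unique because [beta e] is injective. *)
Lemma model_covering : covering model_phi.
Proof.
move=> x; split.
  move=> [[[p s] sp] b] [[[p' s'] sp'] b']; rewrite !inE => /eqP <- /eqP.
  move=> E [es eb]; subst b'; simpl in es; subst s'.
  have epp : p' = p.
    by case: b E; rewrite /end_vert /= => -[] // /perm_inj.
  by subst p'; congr (_, _); apply: val_inj.
apply/setP => -[s b]; rewrite inE; apply/imsetP/eqP.
  by move=> [d]; rewrite inE => /eqP <- E; rewrite E hom_end.
move=> su; have sd : same_end (t (val x).1) (s, b) (s, b).
  by apply: good_vert_end; rewrite // su; apply: (valP x).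
case: b su sd => su sd.
  pose p := (beta (he (attach X) s))^-1%g (val x).1.
  have pE : beta (he (attach X) s) p = (val x).1 by rewrite /p permKV.
  have sp : same_end (t p) (s, false) (s, false) by rewrite -model_glue pE.
  exists (exist _ (p, s) sp : edge model_bdry, true) => //.
  rewrite inE; apply/eqP/val_inj; rewrite /= pE (su : tgt s = (val x).2).
  exact: (esym (surjective_pairing _)).
exists (exist _ ((val x).1, s) sd : edge model_bdry, false) => //.
rewrite inE; apply/eqP/val_inj; rewrite /= (su : src s = (val x).2).
exact: (esym (surjective_pairing _)).
Qed.

Lemma model_cycles : union_of_cycles model_bdry.
Proof.
move=> x; have [inj im] := model_covering x.
by rewrite /valence -(card_in_imset inj) im; apply: bdry_cycles.
Qed.

Definition model_relV : rel (vert model_bdry) :=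
  fun x y => ((val x).1 == (val y).1) && same_vert (t (val x).1) (val x).2 (val y).2.
(** Edges are compared at their sources; [model_glue] transfers this to their targets, which makes
    the identifications of edges and vertices compatible. *)
Definition model_relE : rel (edge model_bdry) :=
  fun x y => ((val x).1 == (val y).1) &&
    same_end (t (val x).1) ((val x).2, false) ((val y).2, false).

Lemma model_relV_refl : reflexive model_relV.
Proof. by move=> x; rewrite /model_relV eqxx; apply: (valP x). Qed.
Lemma model_relV_sym : symmetric model_relV.
Proof.
move=> x y; rewrite /model_relV eq_sym; apply: andb_id2l => /eqP ->.
exact: good_vert_sym.
Qed.
Lemma model_relV_trans : transitive model_relV.
Proof.
move=> y x z /andP[/eqP xy sxy] /andP[/eqP yz syz].
rewrite /model_relV xy yz eqxx /= -yz -xy; apply: good_vert_trans sxy _ => //.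
by rewrite xy.
Qed.
Lemma model_relE_refl : reflexive model_relE.
Proof. by move=> x; rewrite /model_relE eqxx; apply: (valP x). Qed.
Lemma model_relE_sym : symmetric model_relE.
Proof.
move=> x y; rewrite /model_relE eq_sym; apply: andb_id2l => /eqP ->.
exact: good_end_sym.
Qed.
Lemma model_relE_trans : transitive model_relE.
Proof.
move=> y x z /andP[/eqP xy sxy] /andP[/eqP yz syz].
rewrite /model_relE xy yz eqxx /= -yz -xy; apply: good_end_trans sxy _ => //.
by rewrite xy.
Qed.

Let cV := canon model_relV.
Let cE := canon model_relE.
Let cVK : idempotent_fun cV := canonK model_relV_refl model_relV_sym model_relV_trans.
Let cEK : idempotent_fun cE := canonK model_relE_refl model_relE_sym model_relE_trans.

Let cV_rel x : model_relV x (cV x) := canon_rel model_relV_refl x.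
Let cE_rel x : model_relE x (cE x) := canon_rel model_relE_refl x.
Let cV_eq x y : cV x = cV y <-> model_relV x y :=
  canon_eq model_relV_refl model_relV_sym model_relV_trans x y.
Let cE_eq x y : cE x = cE y <-> model_relE x y :=
  canon_eq model_relE_refl model_relE_sym model_relE_trans x y.

Lemma model_relE_attach x y :
  model_relE x y -> he (attach X) (val x).2 = he (attach X) (val y).2.
Proof. by move=> /andP[_ /(good_end_attach (t_good _))]. Qed.

Lemma model_relV_attach x y :
  model_relV x y -> hv (attach X) (val x).2 = hv (attach X) (val y).2.
Proof. by move=> /andP[_ /(good_vert_attach (t_good _))]. Qed.

Fact model_c_src x : cV (src (cE x)) = cV (src x).
Proof.
apply/cV_eq; rewrite model_relV_sym; have /andP[xy sxy] := cE_rel x.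
by rewrite /model_relV /= xy; apply: good_end_vert sxy.
Qed.

Fact model_c_tgt x : cV (tgt (cE x)) = cV (tgt x).
Proof.
apply/cV_eq; rewrite model_relV_sym; have xy := cE_rel x.
rewrite /model_relV /= -(model_relE_attach xy); case/andP: xy => /eqP <- sxy.
by rewrite eqxx; rewrite -model_glue in sxy; apply: good_end_vert sxy.
Qed.

Definition model_attach := retract_hom cVK cEK model_c_src model_c_tgt.

Lemma model_attach_immersion : immersion model_attach.
Proof.
move=> x y common /retract_edgeE /cE_eq xy.
apply: val_inj; case/andP: (xy) => /eqP pxy _.
have: (val x).2 = (val y).2.
  apply: (@attach_immersion X); last exact: model_relE_attach.
  by case: common => /(congr1 (fun z => (val z).2)); [left|right].
by case: (val x) (val y) pxy => ? ? [? ?] /= -> ->.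
Qed.

Definition model : complex2 := Complex2 model_cycles model_attach_immersion.

Let to_X := comp_hom model_phi (attach X).

Fact model_to_X_V x : hv to_X (cV x) = hv to_X x.
Proof. by rewrite /= -(model_relV_attach (cV_rel x)). Qed.
Fact model_to_X_E x : he to_X (cE x) = he to_X x.
Proof. by rewrite /= -(model_relE_attach (cE_rel x)). Qed.

Definition model_skel : graph_hom (skel model) (skel X) :=
  retract_lift cE cVK model_to_X_V.

Definition model_mor : morphism model X.
Proof.
exists model_skel model_phi.
- exact: (retract_liftK cVK cEK model_c_src model_c_tgt model_to_X_V model_to_X_E).1.
- exact: (retract_liftK cVK cEK model_c_src model_c_tgt model_to_X_V model_to_X_E).2.
- exact: model_covering.
Defined.

(* The finite-sheeted cover of [skel X] with monodromy [beta]. *)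
Definition model_sheets : graph :=
  @Graph (P * vert (skel X))%type (P * edge (skel X))%type
    (fun x => (x.1, src x.2)) (fun x => (beta x.2 x.1, tgt x.2)).

Definition sheets_hom : graph_hom model_sheets (skel X) :=
  @GraphHom model_sheets (skel X) snd snd (fun=> erefl) (fun=> erefl).

Definition to_sheets : graph_hom model_bdry model_sheets.
Proof.
exists (fun x : vert model_bdry => ((val x).1, hv (attach X) (val x).2) : vert model_sheets)
       (fun x : edge model_bdry => ((val x).1, he (attach X) (val x).2) : edge model_sheets).
- by move=> x; rewrite /= hom_src.
- by move=> x; rewrite /= hom_tgt.
Defined.

Fact to_sheets_V x : hv to_sheets (cV x) = hv to_sheets x.
Proof.
by rewrite /= -(model_relV_attach (cV_rel x)); case/andP: (cV_rel x) => /eqP ->.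
Qed.
Fact to_sheets_E x : he to_sheets (cE x) = he to_sheets x.
Proof.
by rewrite /= -(model_relE_attach (cE_rel x)); case/andP: (cE_rel x) => /eqP ->.
Qed.

(** A boundary vertex or edge is determined by its piece and its image in [bdry X], and the piece
    can be read off in [model_sheets]. As each [beta e] is a permutation, this graph immerses in
    [skel X]. *)
Lemma model_face_essential : face_essential model_mor.
Proof.
have [jV jE] := retract_liftK cVK cEK model_c_src model_c_tgt to_sheets_V to_sheets_E.
apply: (@face_essential_of_immersion X model model_mor model_sheets
         (retract_lift cE cVK to_sheets_V) sheets_hom).
- move=> [p e] [p' e'] /= common ee; subst e'.
  by case: common => -[]; [move=> ->|move=> /perm_inj ->].
- by split.
- move=> u u' ju fu; apply: val_inj; move: (jV u) (jV u').
  rewrite /= in ju fu *; rewrite ju => <- [pu _].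
  by case: (val u) (val u') pu fu => ? ? [? ?] /= -> ->.
- move=> u u' ju fu; apply: val_inj; move: (jE u) (jE u').
  rewrite /= in ju fu *; rewrite ju => <- [pu _].
  by case: (val u) (val u') pu fu => ? ? [? ?] /= -> ->.
Qed.

Definition model_pi (x : vert (bdry model)) : P := (val x).1.

Lemma model_chart : chart model_mor model_pi.
Proof.
split.
- by move=> u u' /retract_vertE /cV_eq /andP[/eqP].
- move=> u u' pu fu; apply: val_inj; move: pu fu; rewrite /model_pi /=.
  by case: (val u) (val u') => ? ? [? ?] /= -> ->.
- exact: retract_surj.
Qed.

(** Once [t] is recovered from the model, the lemmas on charts yield visible irreducibility and all
    the counts. *)
Lemma model_ltype p : ltype model_mor model_pi p = t p.
Proof.
rewrite (surjective_pairing (t p)); congr (_, _).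
  apply/setP => -[u u']; apply/pushP/idP.
    move=> [a [a' [<- _ /retract_vertE /cV_eq /andP[_ saa'] <- <-]]].
    exact: saa'.
  move=> uu'; have gd := t_good p.
  have u'u : same_vert (t p) u' u by rewrite good_vert_sym.
  exists (exist _ (p, u) (good_vert_trans gd uu' u'u)).
  exists (exist _ (p, u') (good_vert_trans gd u'u uu')).
  by split=> //; apply/retract_vertE/cV_eq; rewrite /model_relV /= eqxx.
apply/ffunP => b; rewrite ffunE; apply/setP => -[s s']; apply/pushP/idP.
  move=> [a [a' [pa _ /retract_edgeE /cE_eq /andP[_ saa'] <- <-]]].
  case: b pa => pa; last by rewrite -pa; case/andP: saa'.
  by rewrite -pa; rewrite -model_glue in saa'; case/andP: saa'.
move=> ss'; have gd := t_good.
have {}ss' : same_end (t p) (s, b) (s', b) by rewrite /same_end /= eqxx.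
have es := good_end_attach (gd p) ss'; rewrite /= in es.
(* [q] is the piece in which [s] starts: [p] itself for an outgoing end, its preimage under the
   gluing permutation for an incoming one. *)
have [q qp qs] : exists2 q, (if b then beta (he (attach X) s) q else q) = p &
    same_end (t q) (s, false) (s', false).
  case: b ss' => ss'; last by exists p.
  exists ((beta (he (attach X) s))^-1%g p); first by rewrite permKV.
  by rewrite -model_glue permKV.
have qs' : same_end (t q) (s', false) (s, false) by rewrite good_end_sym.
exists (exist _ (q, s) (good_end_trans (gd q) qs qs')).
exists (exist _ (q, s') (good_end_trans (gd q) qs' qs)).
split=> //.
- by case: (b) qp.
- by rewrite es in qp; case: (b) qp.
- by apply/retract_edgeE/cE_eq; rewrite /model_relE /= eqxx.
Qed.

End Model.

Lemma realize (X : complex2) (m : {ffun local_type X -> nat}) : feasible m ->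
  exists (Y : complex2) (f : morphism Y X),
    [/\ visibly_irreducible Y, face_essential f,
        degree f = weight (@type_degree X) m,
        #|vert (skel Y)| = weight (@type_verts X) m &
        #|edge (skel Y)| = weight (@type_edges X) m]
    /\ (degree f = 0 -> m = [ffun=> 0]).
Proof.
move=> [m_good m_glue].
(* The pieces are [m t] copies of each local type [t]. *)
pose P := {t : local_type X & 'I_(m t)}; pose t (p : P) := tag p.
have t_good p : good (t p) by apply: m_good; apply: leq_ltn_trans (ltn_ord (tagged p)).
have /fin_all_exists[beta t_glue] e : exists beta : {perm P}, forall p,
    edges_over (t (beta p)) true e = edges_over (t p) false e.
  apply: (perm_of_fibres (F := fun p => edges_over (t p) false e)
            (G := fun p => edges_over (t p) true e) (k0 := set0)) => R nR.
  by rewrite !card_set_sum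
    (weight_tagged m (fun t => edges_over t _ e == R : nat))
    (weight_tagged m (fun t => edges_over t _ e == R : nat)) m_glue.
have ch := model_chart t_good t_glue.
have lt := model_ltype t_good t_glue.
have sums g : \sum_p g (ltype (model_mor t_good t_glue) (@model_pi _ _ _ _ t_good t_glue) p) = weight g m.
  by rewrite -weight_tagged; apply: eq_bigr => p _; rewrite lt.
exists (model t_good t_glue), (model_mor t_good t_glue); split; [split|].
- by apply: (chart_visibly_irreducible ch) => p _; rewrite lt.
- exact: model_face_essential.
- by rewrite (chart_degree ch) sums.
- by rewrite (chart_card_vert ch) sums.
- by rewrite (chart_card_edge ch) sums.
(* Any piece has a boundary vertex by [good_nonempty], hence the model has a face and positive
   degree. *)
move=> d0; apply/ffunP => x; rewrite ffunE; apply/eqP; rewrite -leqn0 leqNgt.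
apply/negP => mx; pose p : P := Tagged _ (Ordinal mx).
have [u uu] := good_nonempty (t_good p).
have := degree_gt0 (model_mor t_good t_glue) (exist _ (p, u) uu).
by rewrite d0.
Qed.

(** * The monoid of solutions and the maximal ratio *)

Local Open Scope ring_scope.

Lemma weight0 (T : finType) (g : T -> nat) : weight g [ffun=> 0%N] = 0%N.
Proof. by apply: big1 => t _; rewrite ffunE. Qed.

Lemma feasible0 (X : complex2) : @feasible X [ffun=> 0%N].
Proof. by split=> [t|e R _]; rewrite ?ffunE ?weight0. Qed.

Lemma feasibleB (X : complex2) (m b : {ffun local_type X -> nat}) :
  feasible m -> feasible b -> (forall t, (b t <= m t)%N) ->
  feasible [ffun t => (m t - b t)%N].
Proof.
move=> [m_good m_glue] [_ b_glue] le; split=> [t|e R nR].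
  by rewrite ffunE => lt; apply: m_good; apply: leq_trans lt (leq_subr _ _).
have := m_glue e R nR; rewrite !(weightB _ le) (b_glue e R nR); exact: addnI.
Qed.

Theorem theorem4p12 (X : complex2) :
  exists (Ymax : complex2) (fmax : morphism Ymax X),
    [/\ visibly_irreducible Ymax,
        face_essential fmax &
        forall (Y : complex2) (f : morphism Y X),
          visibly_irreducible Y -> face_essential f -> (0 < degree f)%N ->
          (0 < degree fmax)%N /\ curvature_ratio f <= curvature_ratio fmax].
Proof.
have d0 (m : {ffun local_type X -> nat}) :
    feasible m -> weight (@type_degree X) m = 0%N -> m = [ffun=> 0%N].
  by move=> /realize[Y [f [[_ _ <- _ _] nz]]].
(* The Euler characteristic is vertices minus edges, so the vertex and edge counts of local types
   serve as [g] and [h]. *)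
have [b /realize[Ymax [fmax [[vi fe dE vE eE] _]]] max] :=
  max_weight_ratio (@type_verts X) (@type_edges X) (feasible0 X) (@feasibleB X) d0.
exists Ymax, fmax; split=> // Y f viY feY df.
have [m [fm dmE vmE emE]] := feasible_of_essential viY feY.
rewrite dmE in df; have [db le] := max m fm df.
have ratioE (Z : complex2) (h : morphism Z X) : curvature_ratio h =
    ((degree h)%:R + #|vert (skel Z)|%:R - #|edge (skel Z)|%:R) / (degree h)%:R.
  by rewrite /curvature_ratio /total_curvature /euler_char rmorphD rmorphB /= addrA.
by rewrite !ratioE dE vE eE dmE vmE emE.
Qed.
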